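(* Let $\mathcal H$ be an infinite dimensional separable Hilbert space and $\mathcal K$ a Hilbert space. If $F:B(\mathcal H)^{n_1}\times_c\cdots\times_cB(\mathcal H)^{n_k}\to B(\mathcal K)\otimes_{min}B(\mathcal H)$ is an entire function with the property that there are a constant $C>0$ and $\mathbf m:=(m_1,\dots,m_k)\in\mathbb Z_+^k$ such that $$\|F(\mathbf X)\|\le C\left\|\sum_{\boldsymbol\alpha\in\Lambda_{\mathbf m}}b_{1,\alpha_1}\cdots b_{k,\alpha_k}\mathbf X_{\boldsymbol\alpha}\mathbf X_{\boldsymbol\alpha}^*\right\|^{1/2}$$ for any $\mathbf X\in B(\mathcal H)^{n_1}\times_c\cdots\times_cB(\mathcal H)^{n_k}$, then $F$ is a polynomial of degree at most $m_1+\cdots+m_k$. In particular, a bounded entire function must be constant.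
   Context: Polydomains. Fix $k\in\mathbb N=\{1,2,\dots\}$ and $n_1,\dots,n_k\in\mathbb N$. Hilbert spaces are complex; $A>0$ means that the operator $A$ is positive and invertible. $\mathbb F_{n_i}^+$ is the unital free semigroup on generators $g^i_1,\dots,g^i_{n_i}$ with identity $g^i_0$, and $|\alpha|$ is the length of $\alpha$. For $X_i=(X_{i,1},\dots,X_{i,n_i})\in B(\mathcal H)^{n_i}$ put $X_{i,\alpha}:=X_{i,j_1}\cdots X_{i,j_p}$ if $\alpha=g^i_{j_1}\cdots g^i_{j_p}$, and $X_{i,g_0^i}:=I$. Fix $\mathbf q=(q_1,\dots,q_k)$, where each $q_i=\sum_{\alpha\in\mathbb F_{n_i}^+}a_{i,\alpha}Z_\alpha$ is a positive regular polynomial in $n_i$ noncommuting indeterminates: a finite sum with $a_{i,\alpha}\ge0$, $a_{i,g_0^i}=0$ and $a_{i,g_j^i}>0$ for $j=1,\dots,n_i$. Define $\Phi_{q_i,X_i}(Y):=\sum_\alpha a_{i,\alpha}X_{i,\alpha}YX_{i,\alpha}^*$ for $Y\in B(\mathcal H)$. $B(\mathcal H)^{n_1}\times_c\cdots\times_cB(\mathcal H)^{n_k}$ is the set of $\mathbf X=(X_1,\dots,X_k)\in B(\mathcal H)^{n_1}\times\cdots\times B(\mathcal H)^{n_k}$ such that, for $s\ne t$, every entry of $X_s$ commutes with every entry of $X_t$. For $\mathbf p\in\{0,1\}^k$ let $\mathbf\Delta^{\mathbf p}_{\mathbf q,\mathbf X}:=(\mathrm{id}-\Phi_{q_1,X_1})^{p_1}\circ\cdots\circ(\mathrm{id}-\Phi_{q_k,X_k})^{p_k}$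 and $\mathbf\Delta_{\mathbf q,\mathbf X}:=\mathbf\Delta^{(1,\dots,1)}_{\mathbf q,\mathbf X}$. Set $\mathbf D^-_{\mathbf q}(\mathcal H):=\{\mathbf X\in B(\mathcal H)^{n_1}\times_c\cdots\times_cB(\mathcal H)^{n_k}:\mathbf\Delta^{\mathbf p}_{\mathbf q,\mathbf X}(I)\ge0\text{ for all }\mathbf p\in\{0,1\}^k\}$ and $\mathbf D_{\mathbf q}(\mathcal H):=\{\mathbf X\in\mathbf D^-_{\mathbf q}(\mathcal H):\mathbf\Delta_{\mathbf q,\mathbf X}(I)>0\}$. For $\rho>0$, $\rho\mathbf D_{\mathbf q}(\mathcal H):=\{\rho\mathbf X:\mathbf X\in\mathbf D_{\mathbf q}(\mathcal H)\}$; one has $B(\mathcal H)^{n_1}\times_c\cdots\times_cB(\mathcal H)^{n_k}=\bigcup_{\rho>0}\rho\mathbf D_{\mathbf q}(\mathcal H)$. Coefficients and notation. $b_{i,g_0^i}:=1$ and, for $|\alpha|\ge1$, $b_{i,\alpha}:=\sum_{p=1}^{|\alpha|}\sum a_{i,\gamma_1}\cdots a_{i,\gamma_p}$, the inner sum over $\gamma_1,\dots,\gamma_p\in\mathbb F_{n_i}^+$ with $\gamma_1\cdots\gamma_p=\alpha$ and all $|\gamma_l|\ge1$. For $\boldsymbol\alpha=(\alpha_1,\dots,\alpha_k)\in\mathbb F_{n_1}^+\times\cdots\times\mathbb F_{n_k}^+$, $\mathbf X_{\boldsymbol\alpha}:=X_{1,\alpha_1}\cdots X_{k,\alpha_k}$;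 $\Lambda_{\mathbf p}:=\{\boldsymbol\alpha:|\alpha_i|=p_i,\ i=1,\dots,k\}$ for $\mathbf p\in\mathbb Z_+^k$ ($\mathbb Z_+$ the nonnegative integers). Entire functions. $F$ is entire on $B(\mathcal H)^{n_1}\times_c\cdots\times_cB(\mathcal H)^{n_k}$ if it is free holomorphic on every $\rho\mathbf D_{\mathbf q}(\mathcal H)$, $\rho>0$; i.e. there are coefficients $A_{(\boldsymbol\alpha)}\in B(\mathcal K)$ such that $F(\mathbf X)=\sum_{\mathbf p\in\mathbb Z_+^k}\sum_{\boldsymbol\alpha\in\Lambda_{\mathbf p}}A_{(\boldsymbol\alpha)}\otimes\mathbf X_{\boldsymbol\alpha}$, with convergence in the operator norm (unordered sum over $\mathbf p$), for all $\mathbf X\in\rho\mathbf D_{\mathbf q}(\mathcal H)$ and all $\rho>0$. $F$ is a polynomial of degree at most $d$ if $A_{(\boldsymbol\alpha)}=0$ whenever $|\alpha_1|+\cdots+|\alpha_k|>d$. $\otimes_{min}$ is the minimal (spatial) tensor product. *)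

(* Defs.v *)
From HB Require Import structures.
From mathcomp Require Import all_boot all_order all_algebra finmap.
From mathcomp Require Import sesquilinear complex.
From mathcomp Require Import boolp classical_sets functions cardinality fsbigop.
From mathcomp Require Import reals topology normedtype.
From mathcomp Require Import showcase.summability.

Set Implicit Arguments.
Unset Strict Implicit.
Unset Printing Implicit Defensive.

Import Order.TTheory GRing.Theory Num.Theory.
Import numFieldNormedType.Exports.

Local Open Scope classical_set_scope.
Local Open Scope complex_scope.
Local Open Scope ring_scope.

Section BoundedOperators.
Variables (R : realType) (V W : normedModType R[i]).

Definition bounded_op : {pred V -> W} :=
  [pred f | `[< linear f /\ exists M : R, forall x, `|f x| <= M%:C * `|x| >]].

Record bop := Bop { bop_fun :> V -> W; _ : bop_fun \in bounded_op }.

HB.instance Definition _ := [isSub for bop_fun].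
HB.instance Definition _ := [Choice of bop by <:].

Lemma normcE (U : normedModType R[i]) (x : U) : `|x| = (complex.Re `|x|)%:C.
Proof. by rewrite RRe_real// ger0_real. Qed.

Lemma absE (a : R[i]) : `|a| = (complex.Re `|a|)%:C.
Proof. by rewrite RRe_real// ger0_real. Qed.

Lemma Re_norm_ge0 (U : normedModType R[i]) (x : U) : 0 <= complex.Re `|x|.
Proof. by rewrite -ler0c -normcE. Qed.

Fact bounded_op_submod : submod_closed bounded_op.
Proof.
split.
  apply/asboolP; split; first by move=> a u v; rewrite scaler0 addr0.
  by exists 0 => x; rewrite normr0 mul0r.
move=> a f g /asboolP[fl [M fM]] /asboolP[gl [N gN]]; apply/asboolP; split.
  move=> b u v.
  rewrite /= !(addrfctE, scalrfctE)/= fl gl !scalerDr !scalerA (mulrC a b).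
  by rewrite addrACA.
exists (complex.Re `|a| * M + N) => x.
rewrite rmorphD rmorphM /= -absE mulrDl.
apply: (le_trans (ler_normD _ _)); apply: lerD => //.
by rewrite normrZ -mulrA ler_wpM2l.
Qed.
HB.instance Definition _ := GRing.isSubmodClosed.Build _ _ bounded_op
  bounded_op_submod.
HB.instance Definition _ := [SubChoice_isSubLmodule of bop by <:].

Lemma bop_linear (f : bop) : linear f.
Proof. by case: f => f /= /asboolP[]. Qed.

HB.instance Definition _ (f : bop) :=
  GRing.isLinear.Build _ _ _ _ (bop_fun f) (bop_linear f).

Lemma bop_bounded (f : bop) : exists M : R, forall x, `|f x| <= M%:C * `|x|.
Proof. by case: f => f /= /asboolP[]. Qed.

(* sup of |f x| over the closed unit ball; norms take values in R[i], hence the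
   real part. *)
Definition opnorm (f : bop) : R :=
  sup [set complex.Re `|f x| | x in [set x : V | `|x| <= 1]].

Lemma opnorm_has_sup (f : bop) :
  has_sup [set complex.Re `|f x| | x in [set x : V | `|x| <= 1]].
Proof.
split; first by exists (complex.Re `|f 0|), 0 => //=; rewrite normr0 ler01.
have [M fM] := bop_bounded f; exists `|M|; apply/ubP => _ [x /= x1 <-].
rewrite -lecR -normcE (le_trans (fM x))// (@le_trans _ _ (`|M|%:C * `|x|))//.
  by rewrite ler_wpM2r// lecR ler_norm.
by rewrite ler_piMr// ler0c.
Qed.

Lemma opnorm_ge0 (f : bop) : 0 <= opnorm f.
Proof.
have [_ ubf] := opnorm_has_sup f.
apply: (le_trans (Re_norm_ge0 (f 0))); apply: ub_le_sup => //.
by exists 0 => //=; rewrite normr0 ler01.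
Qed.

Lemma opnorm_ub (f : bop) x : `|f x| <= (opnorm f)%:C * `|x|.
Proof.
have [->|x0] := eqVneq x 0; first by rewrite linear0 !normr0 mulr0.
have nx0 : 0 < `|x| by rewrite normr_gt0.
rewrite -ler_pdivrMr//.
have -> : `|f x| / `|x| = `|f (`|x|^-1 *: x)|.
  by rewrite linearZ/= normrZ normfV normr_id mulrC.
rewrite normcE lecR; apply: ub_le_sup; first by have [] := opnorm_has_sup f.
by exists (`|x|^-1 *: x) => //=; rewrite normrZ normfV normr_id mulVf ?gt_eqF.
Qed.

Lemma opnorm_le (f : bop) (M : R) : 0 <= M ->
  (forall x, `|f x| <= M%:C * `|x|) -> opnorm f <= M.
Proof.
move=> M0 fM; apply: ge_sup; first by have [] := opnorm_has_sup f.
apply/ubP => _ [x /= x1 <-]; rewrite -lecR -normcE (le_trans (fM x))//.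
by rewrite ler_piMr// ler0c.
Qed.

Fact opnormD (f g : bop) :
  (opnorm (f + g))%:C <= (opnorm f)%:C + (opnorm g)%:C :> R[i].
Proof.
rewrite -rmorphD lecR/=; apply: opnorm_le => [|x].
  by rewrite addr_ge0// opnorm_ge0.
by rewrite rmorphD/= mulrDl (le_trans (ler_normD _ _))// lerD// opnorm_ub.
Qed.

Fact opnormZ_le (a : R[i]) (f : bop) :
  (opnorm (a *: f))%:C <= `|a| * (opnorm f)%:C :> R[i].
Proof.
rewrite absE.
rewrite -rmorphM lecR/=; apply: opnorm_le => [|x].
  by rewrite mulr_ge0 ?opnorm_ge0// -ler0c -absE.
rewrite rmorphM /= -absE -mulrA.
by rewrite normrZ ler_wpM2l// opnorm_ub.
Qed.

Fact opnormZ (a : R[i]) (f : bop) :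
  (opnorm (a *: f))%:C = `|a| * (opnorm f)%:C :> R[i].
Proof.
apply/eqP; rewrite eq_le opnormZ_le/=.
have [->|a0] := eqVneq a 0; first by rewrite normr0 mul0r ler0c opnorm_ge0.
rewrite -ler_pdivlMl ?normr_gt0// -normfV.
rewrite -[in leLHS](scale1r f) -(mulVf a0) -scalerA.
exact: opnormZ_le.
Qed.

Fact opnorm0_eq0 (f : bop) : (opnorm f)%:C = 0 :> R[i] -> f = 0.
Proof.
move=> f0; apply/val_inj/funext => x /=; apply/eqP.
by rewrite -normr_le0 (le_trans (opnorm_ub f x))// f0 mul0r.
Qed.

HB.instance Definition _ := @Lmodule_isNormed.Build R[i] bop
  (fun f => (opnorm f)%:C) opnormD opnormZ opnorm0_eq0.

End BoundedOperators.
Arguments bounded_op {R} V W.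

Section BoundedEndomorphisms.
Variables (R : realType) (V : normedModType R[i]).

Fact bop_id_subproof : (id : V -> V) \in bounded_op V V.
Proof. by apply/asboolP; split=> //; exists 1 => x; rewrite mul1r. Qed.
Definition bop_id : bop V V := Bop bop_id_subproof.

Fact bop_comp_subproof (f g : bop V V) : (f \o g) \in bounded_op V V.
Proof.
apply/asboolP; split; first by move=> a u v; rewrite /= !linearP.
exists (opnorm f * opnorm g) => x /=.
rewrite (le_trans (opnorm_ub f _))// rmorphM/= -mulrA ler_wpM2l ?opnorm_ub//.
by rewrite ler0c opnorm_ge0.
Qed.
Definition bop_comp (f g : bop V V) : bop V V := Bop (bop_comp_subproof f g).

Fact bop_compA : associative bop_comp.
Proof. by move=> f g h; apply/val_inj. Qed.
Fact bop_comp1l : left_id bop_id bop_comp.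
Proof. by move=> f; apply/val_inj. Qed.
Fact bop_comp1r : right_id bop_id bop_comp.
Proof. by move=> f; apply/val_inj. Qed.
Fact bop_compDl : left_distributive bop_comp +%R.
Proof. by move=> f g h; apply/val_inj. Qed.
Fact bop_compDr : right_distributive bop_comp +%R.
Proof. by move=> f g h; apply/val_inj/funext => x /=; rewrite linearD. Qed.
HB.instance Definition _ := GRing.Zmodule_isPzRing.Build (bop V V)
  bop_compA bop_comp1l bop_comp1r bop_compDl bop_compDr.

End BoundedEndomorphisms.

(* hdot is linear in its first argument and conjugate linear in its second. *)
HB.mixin Record NormedModule_isHilbert (R : realType) H
    of CompleteNormedModule R[i] H := {
  hdot : {dot H for Num.conj : R[i] -> R[i]};
  hdot_norm : forall x : H, `|x| ^+ 2 = hdot x x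
}.
#[short(type="hilbertType")]
HB.structure Definition Hilbert (R : realType) :=
  {H of CompleteNormedModule R[i] H & NormedModule_isHilbert R H}.


Local Notation "''[' u , v ]" := (hdot u v) : ring_scope.

Section HilbertSpaceNotions.
Variables (R : realType) (H : hilbertType R).

Definition separable := exists2 D : set H, countable D & dense D.

Definition infinite_dimensional := ~ exists s : seq H, forall x : H,
  exists c : 'I_(size s) -> R[i], x = \sum_i c i *: s`_i.

(* The Hilbert adjoint, i.e. the unique S with <A x, y> = <x, S y>, which exists
   by the Riesz representation theorem. *)
Definition adjoint (A : bop H H) : bop H H :=
  xget 0 [set S : bop H H | forall x y, '[A x, y] = '[x, S y]].

Definition positive_op (A : bop H H) := forall x, 0 <= '[A x, x].

Definition invertible_op (A : bop H H) := exists S, S * A = 1 /\ A * S = 1.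

End HilbertSpaceNotions.
Arguments separable {R} H.
Arguments infinite_dimensional {R} H.

Section TensorProducts.
Variables (R : realType) (K H T : hilbertType R).

(* T, together with tau : (x, y) |-> x ⊗ y, is the Hilbert space tensor product
   of K and H; this determines (T, tau) up to a unique unitary. *)
Definition hilbert_tensor_product (tau : {bilinear K -> H -> T}) :=
  (forall x x' y y', '[tau x y, tau x' y'] = '[x, x'] * '[y, y']) /\
  dense [set \sum_(p <- s) tau p.1 p.2 | s in [set: seq (K * H)]].

Variable tau : {bilinear K -> H -> T}.

(* A ⊗ X, the unique bounded operator with x ⊗ y |-> A x ⊗ X y *)
Definition op_tensor (A : bop K K) (X : bop H H) : bop T T :=
  xget 0 [set Z : bop T T | forall x y, Z (tau x y) = tau (A x) (X y)].

(* B(K) ⊗_min B(H): the norm closure in B(K ⊗ H) of the algebraic tensor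
   product. *)
Definition min_tensor : set (bop T T) :=
  closure [set \sum_(p <- s) op_tensor p.1 p.2
          | s in [set: seq (bop K K * bop H H)]].

End TensorProducts.

Section RegularPolynomials.
Variables (R : realType) (n : nat).

(* The free semigroup on n generators is seq 'I_n with concatenation; a
   noncommutative polynomial is its finitely supported coefficient function. *)
Definition ncpoly := {fsfun seq 'I_n -> R with 0}.

Definition positive_regular (a : ncpoly) :=
  [/\ forall al, 0 <= a al, a [::] = 0 & forall j, 0 < a [:: j]].

Definition bcoef (a : ncpoly) (al : seq 'I_n) : R :=
  if al is [::] then 1 else
  \sum_(1 <= p < (size al).+1)
    \sum_(g \in [set g : p.-tuple (seq 'I_n) |
                  flatten g = al /\ forall l, (1 <= size (tnth g l))%N])
      \prod_(l < p) a (tnth g l).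

Definition word_op (H : hilbertType R) (X : 'I_n -> bop H H) (al : seq 'I_n) :
  bop H H := \prod_(j <- al) X j.

Definition Phi (H : hilbertType R) (a : ncpoly) (X : 'I_n -> bop H H)
    (Y : bop H H) : bop H H :=
  \sum_(al <- finsupp a)
    (a al)%:C *: (word_op X al * Y * adjoint (word_op X al)).

End RegularPolynomials.

Section Polydomains.
Variables (R : realType) (k : nat) (n : 'I_k -> nat).

Definition multiword := {dffun forall i : 'I_k, seq 'I_(n i)}.

Definition Lambda (p : {ffun 'I_k -> nat}) : set multiword :=
  [set al | forall i, size (al i) = p i].

Variable H : hilbertType R.

Definition op_tuples := forall i : 'I_k, 'I_(n i) -> bop H H.

Definition commuting_tuples : set op_tuples :=
  [set X | forall s t, s != t -> forall i j, GRing.comm (X s i) (X t j)].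

Definition scale_tuples (rho : R) (X : op_tuples) : op_tuples :=
  fun i j => rho%:C *: X i j.

Definition multiword_op (X : op_tuples) (al : multiword) : bop H H :=
  \prod_(i < k) word_op (X i) (al i).

Variable q : forall i : 'I_k, ncpoly R (n i).

Definition Delta (p : {ffun 'I_k -> bool}) (X : op_tuples) :
    bop H H -> bop H H :=
  \big[comp/id]_(i < k) (fun Y => if p i then Y - Phi (q i) (X i) Y else Y).

Definition polydomain_closed : set op_tuples :=
  [set X | commuting_tuples X /\ forall p, positive_op (Delta p X 1)].

Definition polydomain : set op_tuples :=
  [set X | polydomain_closed X /\
    positive_op (Delta [ffun=> true] X 1) /\
    invertible_op (Delta [ffun=> true] X 1)].

Definition multi_bcoef (al : multiword) : R := \prod_i bcoef (q i) (al i).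

End Polydomains.
Arguments Lambda {k} n p.
Arguments commuting_tuples {R k} n H.

Section EntireFunctions.
Variables (R : realType) (k : nat) (n : 'I_k -> nat).
Variable q : forall i : 'I_k, ncpoly R (n i).
Variables (K H T : hilbertType R) (tau : {bilinear K -> H -> T}).
Implicit Type F : op_tuples n H -> bop T T.

(* partial_sum _ @ totally is the net of finite partial sums, here with values
   in B(T) under its operator norm. *)
Definition entire_expansion F (A : multiword n -> bop K K) :=
  forall rho : R, 0 < rho ->
  forall X, (scale_tuples rho @` polydomain q) X ->
  partial_sum (fun p : {ffun 'I_k -> nat} =>
    \sum_(al \in Lambda n p) op_tensor tau (A al) (multiword_op X al)) @ totally
  --> F X.

Definition entire F := exists A, entire_expansion F A.

(* The coefficients of an entire function are unique, so that the second clause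
   speaks of the coefficients of F. *)
Definition polynomial_of_degree_le F (d : nat) :=
  entire F /\
  forall A, entire_expansion F A ->
  forall al : multiword n, (d < \sum_i size (al i))%N -> A al = 0.

End EntireFunctions.

(* Main.v *)
Require Import Defs.
From HB Require Import structures.
From mathcomp Require Import all_boot all_order all_algebra finmap.
From mathcomp Require Import sesquilinear complex.
From mathcomp Require Import boolp classical_sets functions cardinality fsbigop.
From mathcomp Require Import reals topology normedtype.
From mathcomp Require Import ring showcase.summability.
Import Order.TTheory GRing.Theory Num.Theory.
Import numFieldNormedType.Exports.
Local Open Scope classical_set_scope.
Local Open Scope complex_scope.
Local Open Scope ring_scope.

(** Why the theorem holds.  Fix a multiword [al] of total length larger than
    the growth exponent [d] of [F].  The coefficient [A al] is isolated by
    evaluating [F] on one commuting tuple [X] built for [al]: on an orthonormal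
    family [e u] of [H], indexed by the multiwords [u] that are componentwise
    suffixes of [al], the operator [X i j] prepends the letter [j] to the
    [i]-th component, with value 0 when the result is no longer a suffix of
    [al].  Only finitely many homogeneous parts of the expansion of [F] at [X]
    survive, so that [F (t X)] is a polynomial in [t]; its coefficient of top
    degree, the total length of [al], is the single operator
    [A al ⊗ <., e nil> (e al)] ([multiword_op_shift_long],
    [multiword_op_shift_other], [multiword_op_shift_self]).  A polynomial in
    [t] that is [O(t^d)] at infinity has no coefficient beyond degree [d]
    ([leading_coef_eq0]), so this operator vanishes, and therefore
    [A al = 0] ([op_tensor_rank_one_eq0]).  This is
    [coefficient_eq0_of_growth].

    In the first assertion the bounding function is homogeneous: replacing [X]
    by [t X] multiplies it by [t] to the power [m_1 + ... + m_k].  In the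
    second one the growth exponent is 0, hence every coefficient of a
    nonempty multiword vanishes, [X] and [Y] have the same homogeneous parts,
    and [F X = F Y] by uniqueness of limits ([entire_constant]).

    The expansion of [F] may be used at every commuting tuple because such a
    tuple lies in some dilate of the polydomain ([scaled_polydomain_cover]):
    for small [r] all the defect operators of [r X] are within 1/2 of the
    identity, hence positive, and invertible by a fixed point argument.

    The operator [A ⊗ X] is given by choice among the bounded operators with
    the required values on elementary tensors.  Density of the span of these
    tensors makes it unique, whence its homogeneity; existence is established
    for [X] of rank one, through the partial inner product with a vector
    ([partial_inner_product]). *)

Set Implicit Arguments.
Unset Strict Implicit.
Unset Printing Implicit Defensive.

Local Notation "''[' u , v ]" := (hdot u v) : ring_scope.

(** * Inner products *)

Section Hilbert.
Variables (R : realType) (H : hilbertType R).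
Implicit Types u v x y : H.

Lemma hdotC u v : '[u, v] = ('[v, u])^*.
Proof. by rewrite hermC expr0 mul1r. Qed.

Lemma hdotBl u v w : '[u - v, w] = '[u, w] - '[v, w].
Proof. by rewrite linearBl. Qed.
Lemma hdotBr u v w : '[w, u - v] = '[w, u] - '[w, v].
Proof. by rewrite linearB. Qed.
Lemma hdotZl a u w : '[a *: u, w] = a * '[u, w].
Proof. by rewrite linearZl_LR. Qed.
Lemma hdotZr a u w : '[w, a *: u] = a^* * '[w, u].
Proof. by rewrite linearZr_LR. Qed.
Lemma hdot_ge0 u : 0 <= '[u, u].
Proof. by rewrite -hdot_norm exprn_ge0. Qed.

Lemma hdot_cauchy_schwarz u v : `|'[u, v]| <= `|u| * `|v|.
Proof.
have [->|v0] := eqVneq v 0; first by rewrite linear0r !normr0 mulr0.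
have nv : 0 < `|v| by rewrite normr_gt0.
rewrite -ler_sqr ?nnegrE ?mulr_ge0// exprMn.
pose a := '[u, v] / `|v| ^+ 2.
have := hdot_ge0 (u - a *: v).
rewrite hdotBl !hdotBr !hdotZl !hdotZr -!hdot_norm.
have -> : '[v, u] = ('[u, v])^* by exact: hdotC.
have vr : (`|v| ^+ 2)^* = `|v| ^+ 2.
  by apply/CrealP/ger0_real; rewrite exprn_ge0.
have v2 : `|v| ^+ 2 != 0 by rewrite expf_neq0// gt_eqF.
have -> : `|u| ^+ 2 - a^* * '[u, v] - (a * ('[u, v])^* - a * (a^* * `|v| ^+ 2))
   = `|u| ^+ 2 - `|'[u, v]| ^+ 2 / `|v| ^+ 2.
  rewrite normCK /a rmorphM/= fmorphV/= vr divfK// mulrAC subrr subr0.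
  by rewrite [X in _ - X / _]mulrC.
by rewrite subr_ge0 ler_pdivrMr ?exprn_gt0.
Qed.

Lemma hdot_inj u v : (forall x, '[u, x] = '[v, x]) -> u = v.
Proof.
move=> uv; apply/eqP; rewrite -subr_eq0 -normr_eq0 -sqrf_eq0 hdot_norm.
by rewrite hdotBl uv subrr.
Qed.

End Hilbert.

(** * Complete spaces and operators close to the identity *)

(** A positive element of [R[i]] is real, which reduces epsilon arguments over
    [R[i]] to the archimedean field [R]. *)
Lemma gt0_realC (R : realType) (e : R[i]) : 0 < e -> e = (complex.Re e)%:C.
Proof. by move=> e0; rewrite RRe_real// gtr0_real. Qed.

Lemma ltr0c (R : realType) (k : R) : (0 < k%:C) = (0 < k).
Proof. exact: (ltcR 0 k). Qed.

Section Completeness.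
Variables (R : realType).

Lemma harmonic_small (c e : R) : 0 < e -> exists n, c / n.+1%:R < e.
Proof.
move=> e0; exists (Num.bound `|c / e|).
rewrite ltr_pdivrMr ?ltr0n// mulrC -ltr_pdivrMr//.
rewrite (le_lt_trans (ler_norm _))//.
by rewrite (lt_trans (archi_boundP (normr_ge0 _)))// ?ltr_nat.
Qed.

(** The rate [c / (n + 1)] serves both limits taken below: it dominates the
    geometric rate of a contraction, and it can be imposed on the
    approximations supplied by a dense set. *)
Lemma harmonic_cauchy_cvg (V : completeNormedModType R[i]) (u : nat -> V)
    (c : R) :
  (forall n m, (n <= m)%N -> `|u m - u n| <= (c / n.+1%:R)%:C) ->
  exists l, forall n, `|l - u n| <= (c / n.+1%:R)%:C.
Proof.
move=> uc; have /cauchy_cvgP ucvg : cauchy (u @ \oo).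
  apply/cauchy_exP => e e0.
  have e0' : 0 < complex.Re e by rewrite -ltr0c -gt0_realC.
  have [n nc] := harmonic_small c e0'; exists (u n).
  exists n => // m /= nm; rewrite -ball_normE/= distrC.
  by rewrite (le_lt_trans (uc _ _ nm))// (gt0_realC e0) ltcR.
exists (lim (u @ \oo)) => n.
apply/ler_addgt0Pl => e e0.
have /cvgrPdist_lt/(_ _ e0)[N _ NP] : u @ \oo --> lim (u @ \oo) by [].
have -> : lim (u @ \oo) - u n =
  lim (u @ \oo) - u (maxn N n) + (u (maxn N n) - u n) by rewrite addrA subrK.
rewrite (le_trans (ler_normD _ _))// lerD//.
  by apply/ltW/NP; rewrite /= leq_maxl.
by apply: uc; rewrite leq_maxr.
Qed.

End Completeness.

Section Invertible.
Variables (R : realType) (H : hilbertType R).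

(** Solving [Z x = y] means finding a fixed point of [x |-> y + (x - Z x)],
    which is a contraction of ratio 1/2; its iterates from 0 converge. *)
Lemma half_close_surjective (Z : bop H H) :
  (forall x, `|Z x - x| <= (2^-1)%:C * `|x|) -> forall y, exists x, Z x = y.
Proof.
move=> Zc y; pose g (x : H) := y + (x - Z x).
pose u n := iter n g 0.
have gl x x' : `|g x - g x'| <= (2^-1)%:C * `|x - x'|.
  have -> : g x - g x' = - (Z (x - x') - (x - x')).
    have -> : Z (x - x') = Z x - Z x' by rewrite linearB.
    by rewrite opprB /g opprD addrACA subrr add0r opprD addrACA -opprD.
  by rewrite normrN.
have ub n : `|u n| <= 2%:C * `|y|.
  elim: n => [|n IH]; first by rewrite /u/= normr0 mulr_ge0// ler0c.
  have -> : u n.+1 = y - (Z (u n) - u n) by rewrite /u/= /g opprB.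
  rewrite (le_trans (ler_normB _ _))// -[2]/(1 + 1 : R) rmorphD rmorph1 mulrDl !mul1r.
  rewrite lerD2l (le_trans (Zc _))//.
  rewrite (le_trans (ler_wpM2l _ IH)) ?ler0c ?invr_ge0//.
  by rewrite mulrA -rmorphM mulVf ?pnatr_eq0// rmorph1 mul1r.
(* [c] only has to dominate [2 |y|], the bound on the orbit. *)
pose c := 4 * complex.Re `|y|.
have ud m n : `|u (n + m)%N - u n| <= ((2 ^+ n)^-1)%:C * (c)%:C.
  elim: n => [|n IH].
    rewrite add0n expr0 invr1 rmorph1 mul1r subr0 (le_trans (ub _))//.
    rewrite /c rmorphM/= -Defs.normcE ler_wpM2r// lecR.
    by rewrite ler_nat.
  rewrite addSn /u !iterS -/(u _) (le_trans (gl _ _))//.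
  rewrite exprS invfM rmorphM/= -mulrA ler_wpM2l// ler0c invr_ge0//.
have c0 : 0 <= c by rewrite mulr_ge0// Re_norm_ge0.
have uc n m : (n <= m)%N -> `|u m - u n| <= (c / n.+1%:R)%:C.
  move=> nm; rewrite -(subnKC nm) (le_trans (ud _ _))//.
  rewrite -rmorphM lecR mulrC ler_wpM2l// lef_pV2 ?posrE ?exprn_gt0//.
  by rewrite -natrX ler_nat ltn_expl.
have [l ul] := harmonic_cauchy_cvg uc.
exists l; have gll : `|g l - l| = 0.
  apply/eqP; rewrite eq_le normr_ge0 andbT; apply/ler_addgt0Pl => e e0.
  have e0' : 0 < complex.Re e by rewrite -ltr0c -gt0_realC.
  have [n nc] := harmonic_small (c *+ 2) e0'.
  rewrite addr0 (gt0_realC e0).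
  have -> : g l - l = g l - g (u n) - (l - u n.+1).
    by rewrite opprB addrA /u/= subrK.
  rewrite (le_trans (ler_normB _ _))//.
  apply: (le_trans (lerD (gl _ _) (ul _))).
  apply: (@le_trans _ _ ((c / n.+1%:R)%:C + (c / n.+1%:R)%:C)); last first.
    by rewrite -rmorphD/= lecR -mulr2n -mulrnAl ltW.
  apply: lerD.
    rewrite (le_trans _ (ul n))// ler_piMl// -[leRHS]/(1%:C) lecR invf_le1 ?ltr0n//.
    by rewrite ler1n.
  by rewrite lecR ler_wpM2l// lef_pV2 ?posrE ?ltr0n// ler_nat.
move/eqP: gll; rewrite normr_eq0 /g addrA addrAC addrK subr_eq0.
by move=> /eqP.
Qed.

(** Besides surjectivity, [|x| <= 2 |Z x|] gives injectivity and the bound on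
    the inverse. *)
Lemma half_close_invertible (Z : bop H H) :
  (forall x, `|Z x - x| <= (2^-1)%:C * `|x|) -> invertible_op Z.
Proof.
move=> Zc; have /choice[S ZS] := half_close_surjective Zc.
have Zlb x : `|x| <= 2%:C * `|Z x|.
  have h : `|x| <= `|Z x| + (2^-1)%:C * `|x|.
    rewrite -[X in `|X| <= _](subKr (Z x)) (le_trans (ler_normB _ _))//.
    by rewrite lerD2l.
  have : (1 - 2^-1)%:C * `|x| <= `|Z x|.
    by rewrite rmorphB rmorph1 mulrBl mul1r lerBlDr.
  rewrite {1}[1]splitr mul1r addrK.
  rewrite -(ler_pM2l (_ : 0 < 2%:C :> R[i])) ?ltr0c// mulrA -rmorphM.
  by rewrite mulfV ?pnatr_eq0// rmorph1 mul1r.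
have Z0 x : Z x = 0 -> x = 0.
  by move=> zx; apply/eqP; rewrite -normr_le0 (le_trans (Zlb _))// zx normr0 mulr0.
have SZ x : S (Z x) = x.
  by apply/eqP; rewrite -subr_eq0; apply/eqP/Z0; rewrite linearB/= ZS subrr.
have Sb : (S : H -> H) \in bounded_op H H.
  apply/asboolP; split => [a u v|].
    by rewrite -{1}(ZS u) -{1}(ZS v) -linearP SZ.
  by exists 2 => x; rewrite -{2}(ZS x).
by exists (Bop Sb); split; apply/val_inj/funext => x /=; rewrite ?SZ ?ZS.
Qed.

End Invertible.

(** * Evaluation and scaling of operators *)

Section BopAlgebra.
Variables (R : realType) (V : normedModType R[i]).
Implicit Types (f g : bop V V) (a : R[i]).

Lemma bop_ext f g : (forall x, f x = g x) -> f = g.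
Proof. by move=> fg; apply/val_inj/funext. Qed.

Lemma bop0E x : (0 : bop V V) x = 0.
Proof. by []. Qed.

Lemma bop_mulE f g x : (f * g) x = f (g x).
Proof. by []. Qed.

Lemma bop_subE f g x : (f - g) x = f x - g x.
Proof. by []. Qed.

Lemma bop_scaleE a f x : (a *: f) x = a *: f x.
Proof. by []. Qed.

Lemma bop_scalerAl a f g : (a *: f) * g = a *: (f * g).
Proof. exact/val_inj. Qed.

Lemma bop_scalerAr a f g : f * (a *: g) = a *: (f * g).
Proof. by apply/val_inj/funext => x; exact: linearZ. Qed.

End BopAlgebra.

Lemma bop_sumE (R : realType) (V : normedModType R[i]) (I : Type) (s : seq I)
  (P : pred I) (F : I -> bop V V) x :
  (\sum_(i <- s | P i) F i) x = \sum_(i <- s | P i) F i x.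
Proof. exact: (big_morph (fun f : bop V V => f x)). Qed.

Section Adjoint.
Variables (R : realType) (H : hilbertType R).
Implicit Types A : bop H H.

(** The adjoint is defined by choice, with value 0 in the absence of a
    candidate.  Both alternatives make [W * Y * adjoint W] have a real
    quadratic form as soon as [Y] has one, and both are compatible with real
    scaling ([adjointZ]). *)
Lemma adjoint_cases A :
  (forall x y, '[A x, y] = '[x, adjoint A y]) \/ adjoint A = 0.
Proof.
have [[S AS]|nS] := pselect (exists S : bop H H, forall x y, '[A x, y] = '[x, S y]).
  by left; apply: (@xgetI _ 0 [set S : bop H H | forall x y, '[A x, y] = '[x, S y]] S).
by right; apply: xgetPN => S AS; apply: nS; exists S.
Qed.

Lemma adjoint_eq A (S : bop H H) :
  (forall x y, '[A x, y] = '[x, S y]) -> adjoint A = S.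
Proof.
move=> AS; apply: xget_unique => // S' AS'.
apply/val_inj/funext => y; apply: hdot_inj => x /=.
by rewrite hdotC -AS' AS -hdotC.
Qed.

Lemma adjointZ (r : R) A : r != 0 -> adjoint (r%:C *: A) = r%:C *: adjoint A.
Proof.
move=> r0; have rC : (r%:C)^* = r%:C :> R[i].
  by apply/CrealP/complex_realP; exists r.
have rC0 : r%:C != 0 :> R[i] by rewrite (inj_eq (@complexI R)).
have [AA|A0] := adjoint_cases A.
  by apply: adjoint_eq => x y; rewrite hdotZl AA hdotZr rC.
rewrite A0 scaler0; have [rA|//] := adjoint_cases (r%:C *: A).
set S := adjoint (r%:C *: A) in rA *.
suff AS : forall x y, '[A x, y] = '[x, (r%:C^-1 *: S) y].
  have SA := adjoint_eq AS.
  by move: A0; rewrite SA => /(congr1 (fun B => r%:C *: B)); rewrite scalerA mulfV// scaler0 scale1r.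
move=> x y; rewrite hdotZr fmorphV/= rC -rA hdotZl mulrA mulVf// mul1r.
by [].
Qed.

End Adjoint.

(** * Every commuting tuple lies in a dilate of the polydomain *)

Section WordScaling.
Variables (R : realType) (H : hilbertType R).

Lemma word_opZ (n : nat) (X : 'I_n -> bop H H) (r : R) (w : seq 'I_n) :
  word_op (fun j => r%:C *: X j) w = (r ^+ size w)%:C *: word_op X w.
Proof.
rewrite /word_op; elim: w => [|j w IH]; first by rewrite !big_nil scale1r.
by rewrite !big_cons IH bop_scalerAl bop_scalerAr scalerA -rmorphM -exprS.
Qed.

End WordScaling.

Section NearIdentity.
Variables (R : realType) (H : hilbertType R).

Implicit Types Z : bop H H.

(** The reality of the quadratic form is carried along because [positive_op]
    asks for values that are real as well as nonnegative. *)
Definition near_id (d : R) (Z : bop H H) :=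
  (forall x, '[Z x, x] \is Num.real) /\
  (forall x, `|Z x - x| <= d%:C * `|x|).

(** [<Z x, x> = |x|^2 + <Z x - x, x>], and the second term is at most [|x|^2]
    in modulus. *)
Lemma near_id_positive (d : R) Z : d <= 1 -> near_id d Z -> positive_op Z.
Proof.
move=> d1 [Zr Zd] x.
have xr : '[x, x] \is Num.real by rewrite ger0_real// hdot_ge0.
have : `|'[Z x - x, x]| <= '[x, x].
  rewrite (le_trans (hdot_cauchy_schwarz _ _))// -hdot_norm expr2 ler_wpM2r//.
  by rewrite (le_trans (Zd x))// ler_piMl// -[leRHS]/(1%:C) lecR.
rewrite hdotBl real_ler_norml ?rpredB// => /andP[+ _].
by rewrite lerBrDr addNr.
Qed.

Lemma near_id_norm (d : R) Z x : d <= 1 -> near_id d Z -> `|Z x| <= 2%:C * `|x|.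
Proof.
move=> d1 [_ Zd]; rewrite -(subrK x (Z x)) (le_trans (ler_normD _ _))//.
rewrite -[2]/(1 + 1 : R) rmorphD rmorph1 mulrDl !mul1r lerD2r.
by rewrite (le_trans (Zd x))// ler_piMl// -[leRHS]/(1%:C) lecR.
Qed.

Section Step.
Variables (n : nat) (a : ncpoly R n).
Hypothesis a_reg : positive_regular a.

Definition Phi_bound (X : 'I_n -> bop H H) : R :=
  \sum_(w <- finsupp a)
    a w * (opnorm (word_op X w) * opnorm (adjoint (word_op X w))).

Lemma Phi_bound_ge0 (X : 'I_n -> bop H H) : 0 <= Phi_bound X.
Proof.
have [a0 _ _] := a_reg.
by apply: sumr_ge0 => w _; rewrite !mulr_ge0// opnorm_ge0.
Qed.

Lemma Phi_real (X : 'I_n -> bop H H) Z (x : H) :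
  (forall x, '[Z x, x] \is Num.real) ->
  '[Phi a X Z x, x] \is Num.real.
Proof.
move=> Zr; rewrite /Phi bop_sumE.
rewrite (big_morph (fun y => '[y, x]) (fun u v => linearDl _ _ _ _) (linear0l _ _)).
apply: rpred_sum => w _; rewrite bop_scaleE hdotZl rpredM//.
  by apply/complex_realP; exists (a w).
rewrite !bop_mulE; set W := word_op X w.
have [AA|->] := adjoint_cases W; first by rewrite AA.
by rewrite bop0E !linear0 linear0l; exact: rpred0.
Qed.

(** A regular polynomial has no constant term, so every word of its support has
    length at least 1 and contributes a factor [r ^ (2 |w|) <= r]; the factor 2
    bounds [Z]. *)
Lemma Phi_small (X : 'I_n -> bop H H) Z (r d : R) (x : H) :
  0 < r -> r <= 1 -> d <= 1 -> near_id d Z ->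
  `|Phi a (fun j => r%:C *: X j) Z x| <= (2 * r * Phi_bound X)%:C * `|x|.
Proof.
move=> r0 r1 d1 nZ; have [a0 anil _] := a_reg; rewrite /Phi bop_sumE.
rewrite (le_trans (ler_norm_sum _ _ _))//.
rewrite /Phi_bound mulr_sumr rmorph_sum mulr_suml big_seq [leRHS]big_seq.
apply: ler_sum => w; rewrite mem_finsupp => aw.
have w0 : (0 < size w)%N by case: w aw => //; rewrite anil eqxx.
rewrite word_opZ adjointZ ?expf_neq0 ?gt_eqF//.
set W := word_op X w; set B := adjoint W; set t := r ^+ size w.
have t0 : 0 <= t by rewrite exprn_ge0// ltW.
have tr : t <= r.
  by rewrite /t -(prednK w0) exprS ler_piMr ?(ltW r0)// exprn_ile1 ?(ltW r0).
have nc (s : R) : 0 <= s -> `|s%:C| = s%:C :> R[i].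
  by move=> s0; rewrite ger0_norm// ler0c.
rewrite !(bop_mulE, bop_scaleE) !linearZ/= !scalerA !normrZ !normrM !nc// -!rmorphM.
apply: (@le_trans _ _ ((t * t * a w)%:C *
    ((opnorm W)%:C * (2%:C * ((opnorm B)%:C * `|x|))))).
  rewrite ler_wpM2l ?ler0c ?mulr_ge0//.
  rewrite (le_trans (opnorm_ub _ _))// ler_wpM2l ?ler0c ?opnorm_ge0//.
  rewrite (le_trans (near_id_norm _ d1 nZ))// ler_wpM2l ?ler0c//.
  exact: opnorm_ub.
rewrite !mulrA -!rmorphM ler_wpM2r// lecR.
have -> : t * t * a w * opnorm W * 2 * opnorm B =
  2 * (t * t) * a w * opnorm W * opnorm B by ring.
rewrite !ler_wpM2r ?opnorm_ge0// ler_pM2l//.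
by rewrite (le_trans _ tr)// ler_piMr// (le_trans tr).
Qed.

Lemma near_id_step (X : 'I_n -> bop H H) Z (r d : R) :
  0 < r -> r <= 1 -> d <= 1 -> near_id d Z ->
  near_id (d + 2 * r * Phi_bound X) (Z - Phi a (fun j => r%:C *: X j) Z).
Proof.
move=> r0 r1 d1 nZ; have [Zr Zd] := nZ; split => x.
  by rewrite bop_subE hdotBl rpredB// Phi_real.
rewrite bop_subE addrAC (le_trans (ler_normB _ _))// rmorphD mulrDl lerD//.
exact: (Phi_small _ _ _ _ d1).
Qed.

End Step.
End NearIdentity.

Section Membership.
Variables (R : realType) (k : nat) (n : 'I_k -> nat).
Variables (H : hilbertType R) (q : forall i : 'I_k, ncpoly R (n i)).
Hypothesis q_reg : forall i, positive_regular (q i).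

(** Each factor [id - Phi_i] moves the operator away from the identity by at
    most [2 r Phi_bound_i]; the induction runs over the composition that
    defines [Delta]. *)
Lemma near_id_Delta (X : op_tuples n H) (r : R) (p : {ffun 'I_k -> bool}) :
  0 < r -> r <= 1 -> 2 * r * (\sum_i Phi_bound (q i) (X i)) <= 2^-1 ->
  near_id 2^-1 (Delta q p (scale_tuples r X) 1).
Proof.
move=> r0 r1 rs.
have e0 i : 0 <= 2 * r * Phi_bound (q i) (X i).
  by rewrite !mulr_ge0// ?Phi_bound_ge0// ltW.
suff : forall s : seq 'I_k,
    \sum_(i <- s) 2 * r * Phi_bound (q i) (X i) <= 2^-1 ->
    near_id (\sum_(i <- s) 2 * r * Phi_bound (q i) (X i))
      ((\big[comp/id]_(i <- s) (fun Y => if p i then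
          Y - Phi (q i) (@scale_tuples _ _ _ _ r X i) Y else Y)) (1 : bop H H)).
  move=> /(_ (index_enum _)); rewrite -mulr_sumr => /(_ rs)[Zr Zd].
  split => // x; rewrite (le_trans (Zd x))// ler_wpM2r// lecR//.
elim=> [_|i s IH].
  rewrite !big_nil; split => x /=; first by rewrite ger0_real// hdot_ge0.
  by rewrite subrr normr0 mul0r.
rewrite !big_cons /= => les.
have les' : \sum_(i <- s) 2 * r * Phi_bound (q i) (X i) <= 2^-1.
  by rewrite (le_trans _ les)// lerDr.
have {IH}nZ := IH les'.
case: (p i).
  rewrite addrC; apply: near_id_step => //.
  by rewrite (le_trans les')// invf_le1// ler1n.
case: nZ => Zr Zd; split => // x.
by rewrite (le_trans (Zd x))// ler_wpM2r// lecR lerDr.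
Qed.

Lemma commuting_tuplesZ (X : op_tuples n H) (r : R) :
  commuting_tuples n H X -> commuting_tuples n H (scale_tuples r X).
Proof.
move=> Xc s t st i j; rewrite /GRing.comm /scale_tuples.
by rewrite !bop_scalerAl !bop_scalerAr Xc.
Qed.

Lemma scaled_polydomain_cover (X : op_tuples n H) : commuting_tuples n H X ->
  exists2 rho, 0 < rho & (scale_tuples rho @` polydomain q) X.
Proof.
move=> Xc; pose M := \sum_i Phi_bound (q i) (X i).
have M0 : 0 <= M by apply: sumr_ge0 => i _; rewrite Phi_bound_ge0.
(* With [r = 1 / rho] the total displacement [2 r M] is at most 1/2, and
   [r <= 1]. *)
pose rho := 4 * (1 + M).
have rho4 : 4 <= rho by rewrite ler_peMr// lerDl.
have rho0 : 0 < rho by rewrite (lt_le_trans _ rho4).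
exists rho => //; exists (scale_tuples rho^-1 X); last first.
  rewrite /scale_tuples; apply/functional_extensionality_dep => i.
  apply/funext => j; rewrite scalerA -rmorphM mulfV ?gt_eqF//.
  by rewrite rmorph1 scale1r.
have nD p : near_id 2^-1 (Delta q p (scale_tuples rho^-1 X) 1).
  apply: near_id_Delta; rewrite ?invr_gt0//.
    by rewrite invf_le1// (le_trans _ rho4)// ler1n.
  rewrite -/M mulrAC ler_pdivrMr// /rho mulrA.
  rewrite (_ : 2^-1 * 4 = 2) ?ler_pM2l ?lerDr//.
  by rewrite (natrM _ 2 2) mulKf ?pnatr_eq0.
have half1 : 2^-1 <= 1 :> R by rewrite invf_le1// ler1n.
split; last first.
  split; first exact: near_id_positive (nD _).
  by apply: half_close_invertible; have [] := nD [ffun=> true].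
split; first exact: commuting_tuplesZ.
by move=> p; exact: near_id_positive (nD p).
Qed.

End Membership.

(** * Tensor products of operators *)

Section Tensor.
Variables (R : realType) (K H T : hilbertType R).
Variables (tau : {bilinear K -> H -> T}) (T_tensor : hilbert_tensor_product tau).
Implicit Types (A : bop K K) (X : bop H H) (Z : bop T T).

Lemma tau_dot x x' y y' : '[tau x y, tau x' y'] = '[x, x'] * '[y, y'].
Proof. by case: T_tensor. Qed.

Lemma tau_norm x y : `|tau x y| = `|x| * `|y|.
Proof.
apply/eqP; rewrite -(@eqrXn2 _ 2) ?mulr_ge0//.
by rewrite exprMn !hdot_norm tau_dot.
Qed.

Lemma tensor_approx (u : T) (e : R) : 0 < e ->
  exists s : seq (K * H), `|u - \sum_(p <- s) tau p.1 p.2| <= e%:C.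
Proof.
move=> e0; have [_ dT] := T_tensor.
have e0' : 0 < e%:C :> R[i] by rewrite ltr0c.
have [] := dT (interior (ball u e%:C)).
- by exists u; apply: nbhsx_ballx.
- exact: open_interior.
move=> v [/interior_subset vb [s _ sv]]; exists s.
by move: vb; rewrite sv -ball_normE => /ltW.
Qed.

Lemma bop_tensor_ext Z Z' :
  (forall x y, Z (tau x y) = Z' (tau x y)) -> Z = Z'.
Proof.
move=> ZZ'; apply/eqP; rewrite -subr_eq0; apply/eqP/val_inj/funext => u.
set D := Z - Z'; change (D u = 0).
have D0 (s : seq (K * H)) : D (\sum_(p <- s) tau p.1 p.2) = 0.
  rewrite linear_sum/= big1// => p _.
  by change (Z (tau p.1 p.2) - Z' (tau p.1 p.2) = 0); rewrite ZZ' subrr.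
apply/eqP; rewrite -normr_le0; apply/ler_addgt0Pl => e e0; rewrite addr0.
have e0' : 0 < complex.Re e by rewrite -ltr0c -gt0_realC.
have M0 : 0 < 1 + opnorm D by rewrite ltr_pwDl ?opnorm_ge0.
have [s us] := @tensor_approx u (complex.Re e / (1 + opnorm D)) (divr_gt0 e0' M0).
rewrite -[D u]subr0 -(D0 s) -linearB.
rewrite (le_trans (opnorm_ub _ _))//.
apply: (le_trans (ler_wpM2l _ us)); first by rewrite ler0c opnorm_ge0.
rewrite -rmorphM (gt0_realC e0) lecR mulrA ler_pdivrMr// mulrC.
by rewrite ler_pM2l// lerDr.
Qed.

Lemma op_tensor_cases A X :
  (forall x y, op_tensor tau A X (tau x y) = tau (A x) (X y)) \/
  op_tensor tau A X = 0.
Proof.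
have [[Z AX]|nZ] :=
  pselect (exists Z : bop T T, forall x y, Z (tau x y) = tau (A x) (X y)).
  left; exact: (@xgetI _ 0
    [set Z : bop T T | forall x y, Z (tau x y) = tau (A x) (X y)] Z).
by right; apply: xgetPN => Z AZ; apply: nZ; exists Z.
Qed.

Lemma op_tensor_eq A X Z :
  (forall x y, Z (tau x y) = tau (A x) (X y)) -> op_tensor tau A X = Z.
Proof.
move=> AZ; apply: xget_unique => // Z' AZ'.
by apply: bop_tensor_ext => x y; rewrite AZ AZ'.
Qed.

Lemma op_tensor0l X : op_tensor tau 0 X = 0.
Proof. by apply: op_tensor_eq => x y; rewrite !bop0E linear0l. Qed.

Lemma op_tensor0r A : op_tensor tau A 0 = 0.
Proof. by apply: op_tensor_eq => x y; rewrite !bop0E linear0r. Qed.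

(** When [A ⊗ X] does not exist neither does [A ⊗ aX] for [a] nonzero, and both
    sides are the default value 0. *)
Lemma op_tensorZr A X (a : R[i]) :
  op_tensor tau A (a *: X) = a *: op_tensor tau A X.
Proof.
have [->|a0] := eqVneq a 0; first by rewrite !scale0r op_tensor0r.
have [AX|A0] := op_tensor_cases A X.
  by apply: op_tensor_eq => x y; rewrite !bop_scaleE AX linearZr.
rewrite A0 scaler0; have [AaX|//] := op_tensor_cases A (a *: X).
set Z := op_tensor tau A (a *: X) in AaX *.
have : op_tensor tau A X = a^-1 *: Z.
  apply: op_tensor_eq => x y.
  by rewrite bop_scaleE AaX bop_scaleE linearZr/= scalerA mulVf// scale1r.
rewrite A0 => /(congr1 (fun B => a *: B)).
by rewrite scalerA mulfV// scaler0 scale1r.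
Qed.

Section PartialInnerProduct.
Variable e : H.

(* [z] is the contraction of [u] against [e] in the second factor. *)
Let good (u : T) (z : K) := forall x, '[u, tau x e] = '[z, x].

Let good_linear a u u' z z' : good u z -> good u' z' ->
  good (a *: u + u') (a *: z + z').
Proof. by move=> g g' x; rewrite !linearDl/= !hdotZl g g'. Qed.

(** [|z|^2 = <z, z> = <u, z ⊗ e> <= |u| |z| |e|]. *)
Let good_norm u z : good u z -> `|z| <= `|u| * `|e|.
Proof.
move=> g; have [->|z0] := eqVneq z 0; first by rewrite normr0 mulr_ge0.
rewrite -(ler_pM2r (_ : 0 < `|z|)) ?normr_gt0// -expr2 hdot_norm -g.
rewrite -[leLHS]ger0_norm ?g ?hdot_ge0// -g.
by rewrite (le_trans (hdot_cauchy_schwarz _ _))// tau_norm mulrA mulrAC.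
Qed.

Let good_sum (s : seq (K * H)) :
  exists z, good (\sum_(p <- s) tau p.1 p.2) z.
Proof.
elim: s => [|p s [z gz]].
  by exists 0 => x; rewrite big_nil !linear0l.
exists ('[p.2, e] *: p.1 + z) => x; rewrite big_cons !linearDl/= gz hdotZl.
by rewrite tau_dot mulrC.
Qed.

(** By [good_norm] the contractions of a sequence of finite sums of elementary
    tensors converging to [u] form a Cauchy sequence, whose limit contracts
    [u]. *)
Let good_exists u : exists z, good u z.
Proof.
pose r n : R := 1 / n.+1%:R.
have r0 n : 0 < r n by rewrite divr_gt0// ltr0n.
have /choice[s vs] := fun n => @tensor_approx u (r n) (r0 n).
have /choice[z gs] := fun n => good_sum (s n).
pose v n := \sum_(p <- s n) tau p.1 p.2.
have us n : `|u - v n| <= (r n)%:C by exact: vs.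
have gz n : good (v n) (z n) by exact: gs.
have rle n m : (n <= m)%N -> r m <= r n.
  by move=> nm; rewrite ler_pM2l// lef_pV2 ?posrE ?ltr0n// ler_nat.
pose c := 2 * complex.Re `|e|.
have zc n m : (n <= m)%N -> `|z m - z n| <= (c / n.+1%:R)%:C.
  move=> nm.
  have gd : good (v m - v n) (z m - z n).
    have := good_linear (-1) (gz n) (gz m).
    by rewrite !scaleN1r [- v n + _]addrC [- z n + _]addrC.
  rewrite (le_trans (good_norm gd))//.
  have -> : v m - v n = (u - v n) - (u - v m) by rewrite opprB [RHS]addrC addrA subrK.
  have -> : c / n.+1%:R = (r n + r n) * complex.Re `|e|.
    by rewrite /c /r; ring.
  rewrite rmorphM/= -Defs.normcE ler_wpM2r// (le_trans (ler_normB _ _))//.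
  rewrite rmorphD lerD//.
  by rewrite (le_trans (us m))// lecR rle.
have [l lz] := harmonic_cauchy_cvg zc.
exists l => x; apply/eqP; rewrite -subr_eq0 -normr_le0.
apply/ler_addgt0Pl => d d0; rewrite addr0.
have d0' : 0 < complex.Re d by rewrite -ltr0c -gt0_realC.
have [n nd] := harmonic_small (complex.Re `|x| * complex.Re `|e| + c * complex.Re `|x|) d0'.
have -> : '[u, tau x e] - '[l, x] = '[u - v n, tau x e] - '[l - z n, x].
  by rewrite !hdotBl gz opprB addrA subrK.
rewrite (gt0_realC d0) (le_trans (ler_normB _ _))//.
move/ltW: nd; rewrite -lecR; apply: le_trans.
rewrite mulrDl rmorphD/=; apply: lerD.
  rewrite (le_trans (hdot_cauchy_schwarz _ _))// tau_norm mulrC !rmorphM/=.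
  rewrite -!Defs.normcE ler_wpM2l ?mulr_ge0// (le_trans (us n))// /r mul1r.
  by [].
rewrite (le_trans (hdot_cauchy_schwarz _ _))// mulrAC rmorphM/= -Defs.normcE.
by rewrite ler_wpM2r.
Qed.

(** The map [id ⊗ <., e>] from [T] to [K], the adjoint of [x |-> x ⊗ e]. *)
Lemma partial_inner_product : exists2 S : T -> K,
  linear S /\ (forall u, `|S u| <= `|u| * `|e|) &
  forall x y, S (tau x y) = '[y, e] *: x.
Proof.
have /choice[S gS] := good_exists.
have S_eq u z : good u z -> S u = z.
  by move=> g; apply: hdot_inj => x; rewrite -gS g.
exists S; last by move=> x y; apply: S_eq => x'; rewrite tau_dot hdotZl mulrC.
split=> [a u v|u]; last exact: good_norm.
by apply: S_eq; exact: good_linear.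
Qed.

End PartialInnerProduct.

Section RankOne.
Variables e f : H.

Fact rank_one_subproof : (fun v => '[v, e] *: f) \in bounded_op H H.
Proof.
apply/asboolP; split.
  by move=> a u v /=; rewrite linearDl/= hdotZl scalerDl scalerA.
exists (complex.Re `|e| * complex.Re `|f|) => v /=.
rewrite normrZ rmorphM/= -!Defs.normcE [leRHS]mulrAC ler_wpM2r//.
by rewrite mulrC hdot_cauchy_schwarz.
Qed.

Definition rank_one : bop H H := Bop rank_one_subproof.

Lemma rank_oneE v : rank_one v = '[v, e] *: f. Proof. by []. Qed.

(** [A ⊗ <., e> f] exists: it is the partial inner product with [e], followed by
    [A] and by [x |-> x ⊗ f]. *)
Lemma op_tensor_rank_one A x y :
  op_tensor tau A rank_one (tau x y) = tau (A x) (rank_one y).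
Proof.
have [S [Sl Sb] Stau] := partial_inner_product e.
have Zb : (fun u => tau (A (S u)) f) \in bounded_op T T.
  apply/asboolP; split => [a u v|]; first by rewrite Sl linearP linearPl.
  exists (opnorm A * complex.Re `|e| * complex.Re `|f|) => u.
  rewrite tau_norm !rmorphM/= -!Defs.normcE [leRHS]mulrAC ler_wpM2r//.
  rewrite (le_trans (opnorm_ub _ _))// -mulrA ler_wpM2l ?ler0c ?opnorm_ge0//.
  by rewrite mulrC.
have ZE x' y' : Bop Zb (tau x' y') = tau (A x') (rank_one y').
  by rewrite /= Stau linearZ/= linearZl linearZr.
by rewrite (op_tensor_eq ZE) ZE.
Qed.

(** Evaluate at [x ⊗ e], whose image is [|e|^2 (A x ⊗ f)]. *)
Lemma op_tensor_rank_one_eq0 A : e != 0 -> f != 0 ->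
  op_tensor tau A rank_one = 0 -> A = 0.
Proof.
move=> e0 f0 A0; apply/val_inj/funext => x.
have := op_tensor_rank_one A x e; rewrite A0 bop0E rank_oneE linearZr/=.
move/esym/eqP; rewrite scaler_eq0 -hdot_norm expf_eq0/= normr_eq0 (negPf e0)/=.
rewrite -normr_eq0 tau_norm mulf_eq0 !normr_eq0 (negPf f0) orbF.
by move/eqP.
Qed.

End RankOne.
End Tensor.

(** * Finite orthonormal families *)

Section Orthonormal.
Variables (R : realType) (H : hilbertType R).
Hypothesis H_inf : infinite_dimensional H.

Lemma hdot_suml (I : Type) (s : seq I) (F : I -> H) v :
  '[\sum_(i <- s) F i, v] = \sum_(i <- s) '[F i, v].
Proof.
exact: (big_morph (fun y => '[y, v]) (fun u w => linearDl _ _ _ _)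
  (linear0l _ _)).
Qed.

(** Gram-Schmidt: a vector outside the span of the first [N] ones exists in
    infinite dimension. *)
Lemma orthonormal_sequence N : exists e : nat -> H,
  forall i j, (i < N)%N -> (j < N)%N -> '[e i, e j] = (i == j)%:R.
Proof.
elim: N => [|N [e eN]]; first by exists (fun=> 0).
have [x xe] : exists x : H, forall c : 'I_N -> R[i], x <> \sum_i c i *: e i.
  apply: contrapT => nx; apply: H_inf; exists (mkseq e N) => x.
  have [c xc] : exists c : 'I_N -> R[i], x = \sum_i c i *: e i.
    by apply: contrapT => nc; apply: nx; exists x => c xc; apply: nc; exists c.
  rewrite size_mkseq; exists c; rewrite xc; apply: eq_bigr => i _.
  by rewrite nth_mkseq.
pose y := x - \sum_(i < N) '[x, e i] *: e i.
have y0 : y != 0.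
  by apply/eqP => /eqP; rewrite subr_eq0 => /eqP; exact: xe.
have yN : `|y| != 0 by rewrite normr_eq0.
have ye j : (j < N)%N -> '[y, e j] = 0.
  move=> jN; rewrite hdotBl hdot_suml (bigD1 (Ordinal jN))//= hdotZl eN// eqxx.
  rewrite mulr1 big1 ?addr0 ?subrr// => i ij.
  by rewrite hdotZl eN// (_ : _ == j = false) ?mulr0//; apply/negbTE.
exists (fun i => if (i < N)%N then e i else `|y|^-1 *: y) => i j.
rewrite !ltnS (leq_eqVlt i) (leq_eqVlt j) => /predU1P[->|iN] /predU1P[->|jN].
- rewrite ltnn eqxx hdotZl hdotZr -hdot_norm.
  rewrite fmorphV/= (CrealP _) ?ger0_real// expr2 mulKf// mulVf//.
- by rewrite ltnn jN hdotZl ye// mulr0 gtn_eqF.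
- by rewrite ltnn iN hdotZr hdotC ye// conjC0 mulr0 ltn_eqF.
- by rewrite iN jN eN.
Qed.

(** The family is indexed by a whole type and extended by 0 off [E], so that the
    shifts below need no case distinction when they leave [E]. *)
Lemma orthonormal_family (I : eqType) (E : seq I) : uniq E ->
  exists e : I -> H, forall u v, '[e u, e v] = ((u == v) && (u \in E))%:R.
Proof.
move=> uE; have [e eE] := orthonormal_sequence (size E).
exists (fun u => if u \in E then e (index u E) else 0) => u v.
case: ifPn => uiE; last by rewrite andbF linear0l.
rewrite andbT; case: ifPn => viE; last first.
  rewrite linear0r; case: eqP => // uv.
  by move: viE; rewrite -uv uiE.
rewrite eE ?index_mem//; congr (_%:R); congr nat_of_bool.
apply/eqP/eqP => [uv|->//].
by rewrite -[LHS](nth_index u uiE) uv nth_index.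
Qed.

End Orthonormal.

(** * The monoid of multiwords *)

Section Multiwords.
Variables (k : nat) (n : 'I_k -> nat).
Implicit Types u v w : multiword n.

Definition mcat u v : multiword n := [ffun i => u i ++ v i].
Definition mnil : multiword n := [ffun i => [::]].
Definition minj i (w : seq 'I_(n i)) : multiword n :=
  [ffun s => eqtype.dfwith (fun s => [::] : seq 'I_(n s)) w s].

Lemma mcatE u v i : mcat u v i = u i ++ v i. Proof. by rewrite ffunE. Qed.
Lemma mnilE i : mnil i = [::]. Proof. by rewrite ffunE. Qed.

Lemma mcatA : associative mcat.
Proof. by move=> u v w; apply/ffunP => i; rewrite !ffunE catA. Qed.
Lemma mcat0l : left_id mnil mcat.
Proof. by move=> u; apply/ffunP => i; rewrite !ffunE. Qed.
Lemma mcat0r : right_id mnil mcat.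
Proof. by move=> u; apply/ffunP => i; rewrite !ffunE cats0. Qed.

HB.instance Definition _ := Monoid.isLaw.Build _ mnil mcat mcatA mcat0l mcat0r.

Lemma minjE i (w : seq 'I_(n i)) : minj w i = w.
Proof. by rewrite ffunE eqtype.dfwith_in. Qed.
Lemma minjE_out i (w : seq 'I_(n i)) s : i != s -> minj w s = [::].
Proof. by move=> si; rewrite ffunE eqtype.dfwith_out. Qed.

Lemma minj0 i : minj ([::] : seq 'I_(n i)) = mnil.
Proof.
apply/ffunP => s; rewrite mnilE; have [<-|si] := eqVneq i s; first exact: minjE.
exact: minjE_out.
Qed.

Lemma minj_cat i (w w' : seq 'I_(n i)) : minj (w ++ w') = mcat (minj w) (minj w').
Proof.
apply/ffunP => s; rewrite mcatE; have [<-|si] := eqVneq i s.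
  by rewrite !minjE.
by rewrite !minjE_out.
Qed.

Lemma minjC i j (w : seq 'I_(n i)) (w' : seq 'I_(n j)) : i != j ->
  mcat (minj w) (minj w') = mcat (minj w') (minj w).
Proof.
move=> ij; apply/ffunP => s; rewrite !mcatE.
have [<-|si] := eqVneq i s; first by rewrite (minjE_out w') 1?eq_sym// cats0.
by rewrite (minjE_out w si) cats0.
Qed.

(** The factorisation that mirrors the definition of [multiword_op]. *)
Lemma minj_prod u : \big[mcat/mnil]_(i < k) minj (u i) = u.
Proof.
apply/ffunP => s.
rewrite (big_morph (fun w : multiword n => w s) (fun v w => mcatE v w s) (mnilE s)).
by rewrite (big_only1 s)// ?minjE// => j js _; rewrite minjE_out.
Qed.

Definition msuffix u v := [forall i, suffix (u i) (v i)].

Lemma msuffix_enum v : exists2 E : seq (multiword n), uniq E &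
  forall u, (u \in E) = msuffix u v.
Proof.
pose f (p : {dffun forall i : 'I_k, 'I_(size (v i)).+1}) : multiword n :=
  [ffun i => drop (p i) (v i)].
exists (undup [seq f p | p : {dffun forall i : 'I_k, 'I_(size (v i)).+1}]).
  exact: undup_uniq.
move=> u; rewrite mem_undup; apply/mapP/forallP => [[p _ ->] i|uv].
  by rewrite ffunE; apply/suffixP; exists (take (p i) (v i)); rewrite cat_take_drop.
exists [ffun i => inord (size (v i) - size (u i))%N]; first by rewrite mem_enum.
apply/ffunP => i; rewrite !ffunE inordK ?ltnS ?leq_subr//.
have /suffixP[s vs] := uv i.
by rewrite vs size_cat addnK drop_size_cat.
Qed.

End Multiwords.

(** * Nilpotent shifts attached to a multiword *)

Section Shifts.
Variables (R : realType) (H : hilbertType R) (k : nat) (n : 'I_k -> nat).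
Variables (al : multiword n) (E : seq (multiword n)) (e : multiword n -> H).
Hypotheses (E_uniq : uniq E) (E_suffix : forall u, (u \in E) = msuffix u al).
Hypothesis e_orth : forall u v, '[e u, e v] = ((u == v) && (u \in E))%:R.
Implicit Types u v w be : multiword n.

Definition shift w : bop H H := \sum_(u <- E) rank_one (e u) (e (mcat w u)).

Let shiftE w x : shift w x = \sum_(u <- E) '[x, e u] *: e (mcat w u).
Proof. by rewrite /shift bop_sumE. Qed.

Let e_out u : u \notin E -> e u = 0.
Proof.
move=> uE; apply/eqP; rewrite -normr_eq0 -sqrf_eq0 hdot_norm e_orth.
by rewrite (negPf uE) andbF.
Qed.

Let e_neq0 u : u \in E -> e u != 0.
Proof.
move=> uE; rewrite -normr_eq0 -sqrf_eq0 hdot_norm e_orth uE eqxx.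
exact: oner_neq0.
Qed.

(* Suffixes of [al] are closed under taking suffixes; hence a product of shifts
   never returns to [E] after leaving it. *)
Let E_mcat w u : mcat w u \in E -> u \in E.
Proof.
rewrite !E_suffix => /forallP wu; apply/forallP => i.
by have := wu i; rewrite mcatE => /catl_suffix.
Qed.

Let shift_e w u : shift w (e u) = e (mcat w u).
Proof.
rewrite shiftE; have [uE|uE] := boolP (u \in E); last first.
  rewrite (e_out uE) big1 => [|v _]; last by rewrite linear0l scale0r.
  by rewrite e_out//; apply: contra uE; exact: E_mcat.
rewrite (bigD1_seq u)//= e_orth eqxx uE scale1r big1 ?addr0// => v vu.
by rewrite e_orth eq_sym (negPf vu) scale0r.
Qed.

Lemma shiftM w w' : shift w * shift w' = shift (mcat w w').
Proof.
apply: bop_ext => x; rewrite bop_mulE (shiftE w') linear_sum/= shiftE.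
by apply: eq_bigr => u _; rewrite linearZ/= shift_e mcatA.
Qed.

Definition shift_tuple : op_tuples n H := fun i j => shift (minj [:: j]).

Lemma shift_tuple_commuting : commuting_tuples n H shift_tuple.
Proof.
move=> s t st i j; rewrite /GRing.comm /shift_tuple !shiftM.
by rewrite minjC.
Qed.

(* The empty product of operators is the identity, whereas [shift mnil] is only
   the projection onto the span of the family. *)
Let shifts w (Y : bop H H) := (w = mnil n /\ Y = 1) \/ Y = shift w.

Let shiftsM w w' Y Y' : shifts w Y -> shifts w' Y' -> shifts (mcat w w') (Y * Y').
Proof.
move=> [[-> ->]|->] [[-> ->]|->]; rewrite ?mcat0l ?mcat0r ?mul1r ?mulr1; [left|right..] => //.
by rewrite shiftM.
Qed.

Let shifts_multiword be : shifts be (multiword_op shift_tuple be).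
Proof.
rewrite -[X in shifts X _]minj_prod /multiword_op.
apply: (big_ind2 shifts) => [|w Y w' Y' wY wY'|i _]; first by left.
  exact: shiftsM wY wY'.
rewrite /word_op; elim: (be i) => [|j w IH].
  by rewrite big_nil minj0; left.
rewrite big_cons -cat1s minj_cat; apply: shiftsM => //.
by right.
Qed.

Lemma multiword_op_shift be : be <> mnil n ->
  multiword_op shift_tuple be = shift be.
Proof. by have [[-> _]|] := shifts_multiword be. Qed.

Lemma shift_eq0 w : (forall u, mcat w u \notin E) -> shift w = 0.
Proof.
move=> wE; apply: bop_ext => x; rewrite shiftE big1// => u _.
by rewrite (e_out (wE u)) scaler0.
Qed.

Lemma multiword_op_shift_long be i : (size (al i) < size (be i))%N ->
  multiword_op shift_tuple be = 0.
Proof.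
move=> ab; rewrite multiword_op_shift => [|b0]; last first.
  by move: ab; rewrite b0 mnilE.
apply: shift_eq0 => u; rewrite E_suffix; apply/negP => /forallP/(_ i).
move=> /size_suffix; rewrite mcatE size_cat leqNgt => /negP; apply.
by rewrite ltn_addr.
Qed.

(** If [be u] is a suffix of [al] and [be] has the lengths of [al], then [u] is
    empty and [be = al]. *)
Lemma multiword_op_shift_other be : al <> mnil n ->
  (forall i, size (be i) = size (al i)) -> be != al ->
  multiword_op shift_tuple be = 0.
Proof.
move=> al0 sba ba; rewrite multiword_op_shift => [|b0]; last first.
  apply: al0; apply/ffunP => i; rewrite mnilE.
  by apply/nilP; rewrite /nilp -sba b0 mnilE.
apply: shift_eq0 => u; rewrite E_suffix; apply/negP => /forallP bu.
move/eqP: ba; apply; apply/ffunP => i.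
have /suffixP[s] := bu i; rewrite mcatE => als.
have := congr1 size als; rewrite !size_cat -sba addnCA -[LHS]addn0 => /addnI/esym/eqP.
rewrite addn_eq0 !size_eq0 => /andP[/eqP s0 /eqP u0].
by rewrite als s0 u0 cats0.
Qed.

(** [al u] is a suffix of [al] for the empty [u] only. *)
Lemma multiword_op_shift_self : al <> mnil n ->
  multiword_op shift_tuple al = rank_one (e (mnil n)) (e al).
Proof.
move=> al0; rewrite multiword_op_shift//; apply: bop_ext => x.
rewrite shiftE.
have nE : mnil n \in E.
  by rewrite E_suffix; apply/forallP => i; rewrite mnilE suffix0s.
rewrite (bigD1_seq (mnil n))//= mcat0r big1 ?addr0// => u un.
rewrite [e (mcat _ _)]e_out ?scaler0//; apply: contra un; rewrite E_suffix => /forallP au.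
apply/eqP/ffunP => i; have /size_suffix := au i.
rewrite mcatE size_cat mnilE -[leqRHS]addn0 leq_add2l leqn0 => /nilP.
by [].
Qed.

Lemma shift_ends_neq0 : e (mnil n) != 0 /\ e al != 0.
Proof.
split; apply: e_neq0; rewrite E_suffix; apply/forallP => i.
  by rewrite mnilE suffix0s.
exact: suffix_refl.
Qed.

End Shifts.

(** * Homogeneous parts and growth *)

Section WordGrading.
Variables (k : nat) (n : 'I_k -> nat).

(** Finiteness is what gives the sums over [Lambda n p] their meaning: a sum
    with infinite support would be 0. *)
Lemma finite_Lambda (p : {ffun 'I_k -> nat}) : finite_set (Lambda n p).
Proof.
pose f (w : {dffun forall i : 'I_k, (p i).-tuple 'I_(n i)}) : multiword n :=
  [ffun i => tval (w i)].
apply: (@sub_finite_set _ _ (range f)); last exact/finite_image/finite_finset.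
move=> al /= ap; exists [ffun i => Tuple (introT eqP (ap i))] => //.
by apply/ffunP => i; rewrite !ffunE.
Qed.

Lemma finite_box (a : 'I_k -> nat) :
  finite_set [set p : {ffun 'I_k -> nat} | forall i, (p i <= a i)%N].
Proof.
pose f (w : {dffun forall i : 'I_k, 'I_(a i).+1}) : {ffun 'I_k -> nat} :=
  [ffun i => nat_of_ord (w i)].
apply: (@sub_finite_set _ _ (range f)); last exact/finite_image/finite_finset.
move=> p /= pa; exists [ffun i => inord (p i)] => //.
by apply/ffunP => i; rewrite !ffunE inordK// ltnS.
Qed.

Variables (R : realType) (H : hilbertType R).

Lemma multiword_opZ (X : op_tuples n H) (t : R) (al : multiword n) :
  multiword_op (scale_tuples t X) al =
  (t ^+ (\sum_i size (al i)))%:C *: multiword_op X al.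
Proof.
rewrite /multiword_op.
elim/big_rec3: _ => [|i x y z _ ->]; first by rewrite scale1r.
by rewrite word_opZ bop_scalerAl bop_scalerAr scalerA -rmorphM exprD.
Qed.

End WordGrading.

(** Dividing by [t ^ D] leaves [t |c| <= M] for all [t >= 1]. *)
Lemma leading_coef_eq0 (R : realType) (V : normedModType R[i]) (c : V)
    (M : R[i]) (D : nat) :
  (forall t : R, 1 <= t -> `|(t ^+ D.+1)%:C *: c| <= (t ^+ D)%:C * M) -> c = 0.
Proof.
move=> cM; have tc (t : R) : 1 <= t -> t%:C * `|c| <= M.
  move=> t1; have t0 : 0 < t by rewrite (lt_le_trans _ t1).
  have := cM t t1; rewrite normrZ ger0_norm ?ler0c ?exprn_ge0 ?(ltW t0)//.
  by rewrite exprSr rmorphM -mulrA ler_pM2l// ltr0c exprn_gt0.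
have M0 : 0 <= M.
  by rewrite (le_trans _ (tc 1 _))// rmorph1 mul1r.
apply/eqP; rewrite -normr_le0; apply/ler_addgt0Pl => e e0; rewrite addr0.
pose t := 1 + complex.Re (M / e).
have MeE : (complex.Re (M / e))%:C = M / e.
  by rewrite RRe_real// ger0_real// divr_ge0// ltW.
have t1 : 1 <= t by rewrite lerDl -ler0c MeE divr_ge0// ltW.
have t0 : 0 < t%:C :> R[i] by rewrite ltr0c (lt_le_trans _ t1).
rewrite -(ler_pM2l t0) (le_trans (tc t t1))// /t rmorphD rmorph1/= MeE.
by rewrite mulrDl mul1r divfK ?gt_eqF// lerDr ltW.
Qed.

Section Entire.
Variables (R : realType) (k : nat) (n : 'I_k -> nat).
Variable q : forall i : 'I_k, ncpoly R (n i).
Hypothesis q_reg : forall i, positive_regular (q i).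
Variables (K H T : hilbertType R) (tau : {bilinear K -> H -> T}).
Hypothesis T_tensor : hilbert_tensor_product tau.
Hypothesis H_inf : infinite_dimensional H.

Definition homogeneous_part (A : multiword n -> bop K K) (X : op_tuples n H)
    (p : {ffun 'I_k -> nat}) : bop T T :=
  \sum_(be \in Lambda n p) op_tensor tau (A be) (multiword_op X be).

Lemma homogeneous_partZ A X (t : R) p :
  homogeneous_part A (scale_tuples t X) p =
  (t ^+ (\sum_i p i))%:C *: homogeneous_part A X p.
Proof.
rewrite /homogeneous_part !(fsbig_finite _ _ (finite_Lambda n p)) scaler_sumr.
rewrite big_seq [RHS]big_seq; apply: eq_bigr => be.
rewrite in_fset_set; last exact: finite_Lambda.
rewrite inE => bp; rewrite multiword_opZ (op_tensorZr T_tensor).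
by rewrite (eq_bigr (fun i => p i)) => // i _; exact: bp.
Qed.

Lemma entire_expansion_cvg (F : op_tuples n H -> bop T T) A X :
  entire_expansion q tau F A -> commuting_tuples n H X ->
  partial_sum (homogeneous_part A X) @ totally --> F X.
Proof.
by move=> FA /(scaled_polydomain_cover q_reg)[rho rho0]; exact: FA.
Qed.

Lemma entire_finite_expansion (F : op_tuples n H -> bop T T) A X
    (J : {fset {ffun 'I_k -> nat}}) :
  entire_expansion q tau F A -> commuting_tuples n H X ->
  (forall p, p \notin J -> homogeneous_part A X p = 0) ->
  F X = \sum_(p <- J) homogeneous_part A X p.
Proof.
move=> FA Xc XJ.
apply: (@norm_cvg_unique _ _ _ (fmap_proper_filter _ totally_filter)
  _ _ (entire_expansion_cvg FA Xc)).
apply: (@cvg_near_cst _ _ _ _ _ (totally_filter)); exists J => // J' /= JJ'.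
rewrite /partial_sum -(big_seq_fsetE _ _ predT).
by apply/esym/big_fset_incl => // p _; exact: XJ.
Qed.

(** The core of the proof.  At the shift tuple of [al] all homogeneous parts
    vanish outside a finite box of degrees, and the corner [p0] of the box, the
    only degree of maximal total, carries just the term of [al]. *)
Lemma coefficient_eq0_of_growth (F : op_tuples n H -> bop T T) A (d : nat) :
  entire_expansion q tau F A ->
  (forall X, commuting_tuples n H X -> exists C : R[i],
    forall t : R, 1 <= t -> `|F (scale_tuples t X)| <= (t ^+ d)%:C * C) ->
  forall al : multiword n, (d < \sum_i size (al i))%N -> A al = 0.
Proof.
move=> FA Fd al dal.
have al0 : al <> mnil n.
  by move=> al0; move: dal; rewrite al0 big1// => i _; rewrite mnilE.
have [E uE Eal] := msuffix_enum al.
have [e eE] := orthonormal_family H_inf uE.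
pose X := shift_tuple E e.
have Xc : commuting_tuples n H X by exact: (shift_tuple_commuting uE Eal eE).
pose p0 : {ffun 'I_k -> nat} := [ffun i => size (al i)].
pose G := homogeneous_part A X.
have Gp0 : G p0 = op_tensor tau (A al) (rank_one (e (mnil n)) (e al)).
  rewrite /G /homogeneous_part -(fsbig_widen [set al])/=.
  - by rewrite fsbig_set1 (multiword_op_shift_self uE Eal eE).
  - by move=> _ -> i; rewrite ffunE.
  move=> be [bp ba] /=; rewrite (multiword_op_shift_other uE Eal eE)//.
  - exact: op_tensor0r.
  - by move=> i; rewrite bp ffunE.
  - exact/eqP.
pose J := fset_set [set p : {ffun 'I_k -> nat} | forall i, (p i <= size (al i))%N].
have inJ p : p \in J -> forall i, (p i <= size (al i))%N.
  by rewrite in_fset_set ?inE//; exact: finite_box.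
have GJ p : p \notin J -> G p = 0.
  rewrite in_fset_set; last exact: finite_box.
  move=> pJ; have [i pi] : exists i, (size (al i) < p i)%N.
    apply: contrapT => np; move: pJ; apply/negP/negPn/mem_set => i /=.
    by rewrite leqNgt; apply/negP => pi; apply: np; exists i.
  rewrite /G /homogeneous_part fsbig1// => be bp.
  rewrite (multiword_op_shift_long uE Eal eE (i := i)) ?bp//.
  exact: op_tensor0r.
have p0J : p0 \in J.
  rewrite in_fset_set; last exact: finite_box.
  by rewrite inE => i; rewrite ffunE.
have [C FC] := Fd X Xc.
pose D := (\sum_i size (al i)).-1.
have DE : (\sum_i size (al i) = D.+1)%N by rewrite prednK// (leq_ltn_trans _ dal).
suff G0 : G p0 = 0.
  have [e0 eal0] := shift_ends_neq0 Eal eE.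
  by apply: (op_tensor_rank_one_eq0 T_tensor e0 eal0); rewrite -Gp0.
apply: (@leading_coef_eq0 _ _ _ (C + \sum_(p <- J | p != p0) `|G p|) D) => t t1.
have t0 : 0 <= t by rewrite (le_trans _ t1).
have -> : (t ^+ D.+1)%:C *: G p0 = F (scale_tuples t X) -
    \sum_(p <- J | p != p0) (t ^+ (\sum_i p i))%:C *: G p.
  have tXJ p : p \notin J -> homogeneous_part A (scale_tuples t X) p = 0.
    by move=> pJ; rewrite homogeneous_partZ [homogeneous_part _ _ _]GJ ?scaler0.
  rewrite (entire_finite_expansion FA (commuting_tuplesZ t Xc) tXJ).
  rewrite (bigD1_seq p0) ?fset_uniq// homogeneous_partZ.
  rewrite [X in _ + X - _](eq_bigr _ (fun p _ => homogeneous_partZ A X t p)) addrK -DE.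
  congr ((t ^+ _)%:C *: _).
  by apply: eq_bigr => i _; rewrite ffunE.
rewrite (le_trans (ler_normB _ _))// mulrDr lerD//.
  rewrite (le_trans (FC t t1))//.
  have C0 : 0 <= C.
    rewrite (le_trans (normr_ge0 (F (scale_tuples 1 X))))//.
    by rewrite (le_trans (FC 1 _))// expr1n rmorph1 mul1r.
  by rewrite ler_wpM2r// lecR ler_weXn2l// -ltnS -DE.
rewrite (le_trans (ler_norm_sum _ _ _))// mulr_sumr big_seq_cond [leRHS]big_seq_cond.
apply: ler_sum => p /andP[/inJ pJ pp0].
rewrite normrZ ger0_norm ?ler0c ?exprn_ge0// ler_wpM2r// lecR ler_weXn2l//.
rewrite -ltnS -DE ltn_neqAle leq_sum ?andbT//.
apply: contra pp0 => /eqP ps; apply/eqP/ffunP => i; rewrite ffunE; apply/eqP.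
have := leqif_sum (fun i (_ : true) => leqif_eq (pJ i)).
move=> [_]; rewrite ps eqxx => /esym/forallP/(_ i).
by [].
Qed.

Lemma entire_constant (F : op_tuples n H -> bop T T) A :
  entire_expansion q tau F A ->
  (forall al : multiword n, (0 < \sum_i size (al i))%N -> A al = 0) ->
  forall X Y, commuting_tuples n H X -> commuting_tuples n H Y -> F X = F Y.
Proof.
move=> FA A0 X Y Xc Yc.
have GXY : homogeneous_part A X = homogeneous_part A Y.
  apply/funext => p; apply: eq_fsbigr => al _.
  have [/eqP|/A0->] := posnP (\sum_i size (al i)); last first.
    by rewrite !(op_tensor0l T_tensor).
  rewrite sum_nat_eq0 => /forallP al0; congr (op_tensor _ _ _).
  rewrite /multiword_op; apply: eq_bigr => i _.
  by have /nilP-> := al0 i; rewrite /word_op !big_nil.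
apply: (@norm_cvg_unique _ _ _ (fmap_proper_filter _ totally_filter)
  _ _ (entire_expansion_cvg FA Xc)).
by rewrite /= GXY; exact: entire_expansion_cvg.
Qed.

End Entire.

Theorem theorem2p8 (R : realType) (k : nat) (k_gt0 : (0 < k)%N)
  (n : 'I_k -> nat) (n_gt0 : forall i, (0 < n i)%N)
  (q : forall i : 'I_k, ncpoly R (n i))
  (q_regular : forall i, positive_regular (q i))
  (H : hilbertType R) (H_infinite : infinite_dimensional H)
  (H_separable : separable H)
  (K T : hilbertType R) (tau : {bilinear K -> H -> T})
  (T_tensor : hilbert_tensor_product tau) :
  (forall F : {fun commuting_tuples n H >-> min_tensor tau},
    entire q tau F ->
    forall (C : R) (m : {ffun 'I_k -> nat}), 0 < C ->
    (forall X, commuting_tuples n H X ->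
      `|F X| <= C%:C * sqrtC `|\sum_(al \in Lambda n m)
        (multi_bcoef q al)%:C *:
          (multiword_op X al * adjoint (multiword_op X al))|) ->
    polynomial_of_degree_le q tau F (\sum_i m i)%N) /\
  (forall F : {fun commuting_tuples n H >-> min_tensor tau},
    entire q tau F ->
    (exists M : R, forall X, commuting_tuples n H X -> `|F X| <= M%:C) ->
    exists B : bop T T, forall X, commuting_tuples n H X -> F X = B).
Proof.
split=> F Fe => [C m C0 Fm|[M FM]].
  split=> // A FA; apply: (coefficient_eq0_of_growth q_regular T_tensor H_infinite FA).
  move=> X Xc; exists (C%:C * sqrtC `|\sum_(al \in Lambda n m)
    (multi_bcoef q al)%:C *: (multiword_op X al * adjoint (multiword_op X al))|).
  move=> t t1; have t0 : 0 < t by rewrite (lt_le_trans _ t1).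
  rewrite (le_trans (Fm _ (commuting_tuplesZ t Xc)))// mulrCA ler_pM2l ?ltr0c//.
  set S := \sum_(al \in _) _; set S' := \sum_(al \in _) _.
  (* [t] occurs to the power [|al|] both in the operator and in its adjoint;
     the square root in the bound brings this back to a single power. *)
  have -> : S = ((t ^+ (\sum_i m i)) ^+ 2)%:C *: S'.
    rewrite /S /S' !(fsbig_finite _ _ (finite_Lambda n m)) scaler_sumr.
    rewrite big_seq [RHS]big_seq; apply: eq_bigr => al.
    rewrite in_fset_set; last exact: finite_Lambda.
    rewrite inE => alm; rewrite multiword_opZ adjointZ ?expf_neq0 ?gt_eqF//.
    rewrite bop_scalerAl bop_scalerAr !scalerA -!rmorphM; congr (_ %:C *: _).
    have -> : (\sum_i size (al i) = \sum_i m i)%N.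
      by apply: eq_bigr => i _; exact: alm.
    by ring.
  rewrite normrZ sqrtCM ?nnegrE// ger0_norm ?ler0c ?exprn_ge0 ?(ltW t0)//.
  by rewrite rmorphXn sqrCK// ler0c exprn_ge0// ltW.
have [A FA] := Fe; exists (F (fun i j => 0)) => X Xc.
have A0 : forall al : multiword n, (0 < \sum_i size (al i))%N -> A al = 0.
  apply: (coefficient_eq0_of_growth q_regular T_tensor H_infinite FA).
  move=> Y Yc; exists M%:C => t t1.
  by rewrite expr0 rmorph1 mul1r FM//; exact: commuting_tuplesZ.
exact: (entire_constant q_regular T_tensor FA A0).
Qed.
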